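(* Consider the two-dimensional regular lattice graph $G_m$ with vertex set $V_m$ and path set $\mathcal{P}_m$ (see context), with the Gaussian testing problem $H_0$ versus $H_{1,m}$ with mean shift $\mu_m>0$. (i) If $\mu_m(\log m)^{1/2}\to\infty$ as $m\to\infty$, then there exists a sequence of tests $(T_m)$ that is asymptotically powerful, i.e. $\gamma(T_m)\to 0$. (ii) If $\mu_m\,\log m\,(\log\log m)^{1/2}\to 0$ as $m\to\infty$, then every sequence of tests $(T_m)$ is asymptotically powerless, i.e. $\liminf_{m\to\infty}\gamma(T_m)\ge 1$.
   Context: Regular lattice: $V_m=\{(i,j)\in\mathbb{Z}^2: 0\le i\le m-1,\ -i\le j\le i,\ j\equiv i \pmod 2\}$, with oriented edges $(i,j)\to(i+1,j\pm1)$. The origin is $(0,0)$. $\mathcal{P}_m$ is the set of paths of length $m$ (i.e. visiting $m$ vertices) starting at the origin: sequences $(0,p_0),(1,p_1),\dots,(m-1,p_{m-1})$ with $p_0=0$ and $|p_{i+1}-p_i|=1$. To each vertex $v$ is attached a random variable $X_v$. Under $H_0$ (law $\mathbf{P}_0$), the $X_v$, $v\in V_m$, are i.i.d. $N(0,1)$. Under $H_{1,m}$ with path $p\in\mathcal{P}_m$ (law $\mathbf{P}_{1,p}$), the $X_v$ are independent, $X_v\sim N(\mu_m,1)$ for $v$ on $p$ and $X_v\sim N(0,1)$ otherwise; $p$ is unknown. A test $T_m$ is a measurable $\{0,1\}$-valued function of $(X_v)_{v\in V_m}$ ($1$ = reject $H_0$). Its minimax risk is $\gamma(T_m)=\mathbf{P}_0(T_m=1)+\sup_{p\in\mathcal{P}_m}\mathbf{P}_{1,p}(T_m=0)$.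 A sequence $(T_m)$ is asymptotically powerful if $\gamma(T_m)\to0$ and asymptotically powerless if $\liminf_m\gamma(T_m)\ge1$. *)

(* Defs.v *)
From HB Require Import structures.
From mathcomp Require Import all_boot all_order all_algebra.
From mathcomp Require Import all_classical all_reals all_analysis.
Set Implicit Arguments. Unset Strict Implicit. Unset Printing Implicit Defensive.
Import Order.TTheory GRing.Theory Num.Theory.
Local Open Scope classical_set_scope.
Local Open Scope ring_scope.

(* Vertices of V_m: (i,j) with 0 <= i <= m-1, -i <= j <= i, j = i mod 2.
   Encoded as (i,k) with k <= i and j = 2k - i. *)
Definition vert (m : nat) : finType := {ij : 'I_m * 'I_m | (ij.2 <= ij.1)%N}.
Definition vrow m (v : vert m) : nat := val (sval v).1.
Definition vcol m (v : vert m) : int := (2 * val (sval v).2)%:Z - (vrow v)%:Z.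

(* number of vertices; observations are #|V_m|-tuples of reals, the r-th
   coordinate being X_v for v the r-th element of enum (vert m). *)
Definition nV (m : nat) : nat := #|{: vert m}|.

Definition is_path (m : nat) (p : seq int) : Prop :=
  size p = m /\ nth 0 p 0 = 0 /\
  (forall i : nat, (i.+1 < m)%N -> `|nth 0 p i.+1 - nth 0 p i| = 1).

Definition on_path m (p : seq int) (v : vert m) : bool :=
  nth 0 p (vrow v) == vcol v.

(* Expectation of f under independent N(ms_0,1) x ... x N(ms_{k-1},1),
   as an iterated Lebesgue integral against Gaussian densities. *)
Fixpoint gauss_int {R : realType} (ms : seq R) (f : seq R -> \bar R) : \bar R :=
  match ms with
  | [::] => f [::]
  | m0 :: ms' =>
      (\int[@lebesgue_measure R]_x
         ((normal_pdf m0 1 x)%:E * gauss_int ms' (fun s => f (x :: s))))%E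
  end.

Definition to_tuple {R : realType} (n : nat) (s : seq R) : n.-tuple R :=
  insubd (nseq_tuple n 0) s.

Definition prob_reject {R : realType} (n : nat) (ms : seq R)
  (T : n.-tuple R -> bool) : \bar R :=
  gauss_int ms (fun s => ((T (to_tuple n s))%:R)%:E).

Definition means_H0 {R : realType} (m : nat) : seq R :=
  [seq (0 : R) | v <- enum (vert m)].

Definition means_H1 {R : realType} (m : nat) (mu : R) (p : seq int) : seq R :=
  [seq (if on_path p v then mu else 0) | v <- enum (vert m)].

Definition risk {R : realType} (m : nat) (mu : R) (T : (nV m).-tuple R -> bool)
  : \bar R :=
  (prob_reject (means_H0 m) T +
   ereal_sup [set prob_reject (means_H1 m mu p) (fun x => ~~ T x)
             | p in [set p | is_path m p]])%E.

(* Main.v *)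
(* (i) Reject when the sum over all vertices of [X_v / (row v + 1)] is large. Every
   path shifts the mean of this statistic by the same amount, [mu] times the
   harmonic number [H_m], while its variance is at most [H_m] because row [i]
   has [i + 1] vertices; the Gaussian Chernoff bound gives a risk of at most
   [2 exp (- mu^2 H_m / 8)].

   (ii) By the second moment method it suffices to find a random path [p] such
   that [E exp (mu^2 N)] is close to 1, where [N] is the number of common
   vertices of two independent copies of [p]. Take [S ~ log2 m] levels and give
   the times congruent to [s] modulo [S] to level [s]. On each block of
   [S 2^s] consecutive times, the [2^s] times of level [s] are [U] up-steps
   followed by down-steps, with [U] uniform on [2^s] values and independent of
   everything else. If such a block lies between times [i] and [t] then, given
   the past up to [i], the position at time [t] is injective in [U], so any
   prescribed value has probability at most [2^-s]; choosing [s] as large as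
   possible gives at most [4 S / (t - i)]. Hence at any time the expected number
   of later visits to a given path is [O(log^2 m)], and [N] has exponential
   tails on that scale. *)

Require Import Defs.
From HB Require Import structures.
From mathcomp Require Import all_boot all_order all_algebra.
From mathcomp Require Import all_classical all_reals all_analysis.
From mathcomp Require Import measurable_realfun ring lra zify.
Import Order.TTheory GRing.Theory Num.Theory.
Local Open Scope classical_set_scope.
Local Open Scope ring_scope.

Set Implicit Arguments. Unset Strict Implicit. Unset Printing Implicit Defensive.

(** * Iterated Gaussian integrals *)

Section GaussInt.
Context {R : realType}.
Local Open Scope ereal_scope.
Implicit Types (ms a s : seq R) (f g : seq R -> \bar R).

(** Lists of varying length carry no sigma-algebra here, so measurability is stated for the
    restriction to tuples of a fixed length. *)
Definition meas_seq n f := measurable_fun [set: n.-tuple R] (f \o @tval n R).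

Lemma gauss_int_ge0 ms f : (forall s, 0 <= f s) -> 0 <= gauss_int ms f.
Proof.
elim: ms f => [|m0 ms IH] f f0 //=.
apply: integral_ge0 => x _; apply: mule_ge0; first by rewrite lee_fin normal_pdf_ge0.
by apply: IH => s; exact: f0.
Qed.

Lemma eq_gauss_int ms f g : (forall s, size s = size ms -> f s = g s) ->
  gauss_int ms f = gauss_int ms g.
Proof.
elim: ms f g => [|m0 ms IH] f g fg /=; first exact: fg.
apply: eq_integral => x _; congr (_ * _); apply: IH => s ss.
by rewrite fg//= ss.
Qed.

(** The parameter space [D] is arbitrary so that the induction can absorb the current integration
    variable into it, passing from [D] to [D * R]; each step is then Tonelli. *)
Lemma measurable_gauss_int d (D : measurableType d) ms (F : D -> seq R -> \bar R) :
  (forall x s, 0 <= F x s) ->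
  measurable_fun setT (fun z : D * (size ms).-tuple R => F z.1 (tval z.2)) ->
  measurable_fun setT (fun x => gauss_int ms (F x)).
Proof.
elim: ms d D F => [|m0 ms IH] d D F F0 mF /=.
  have := measurableT_comp mF
    (measurable_fun_pair (@measurable_id _ D setT)
       (@measurable_cst _ _ D _ setT [tuple of [::] : seq R])).
  by [].
apply: (@measurable_fun_fubini_tonelli_F _ _ D _ R lebesgue_measure
  (fun z => (normal_pdf m0 1 z.2)%:E *
            gauss_int ms (fun s => F z.1 (z.2 :: s)))); last first.
  move=> z; apply: mule_ge0; first by rewrite lee_fin normal_pdf_ge0.
  by apply: gauss_int_ge0 => s; exact: F0.
apply: emeasurable_funM.
  apply/measurable_EFinP.
  exact: (measurableT_comp (measurable_normal_pdf m0 1) measurable_snd).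
apply: (IH _ (D * measurableTypeR R)%type (fun z s => F z.1 (z.2 :: s))) => //.
have m1 : measurable_fun setT
    (fun z : (D * measurableTypeR R) * (size ms).-tuple R => z.1.1).
  exact: (measurableT_comp measurable_fst measurable_fst).
have m2 : measurable_fun setT
    (fun z : (D * measurableTypeR R) * (size ms).-tuple R => z.1.2).
  exact: (measurableT_comp measurable_snd measurable_fst).
have m3 := measurable_cons m2 (@measurable_snd _ _ _ _).
exact: (measurableT_comp mF (measurable_fun_pair m1 m3)).
Qed.

Lemma meas_seq_cons n f : meas_seq n.+1 f ->
  measurable_fun setT (fun z : measurableTypeR R * n.-tuple R => f (z.1 :: z.2)).
Proof.
move=> mf.
exact: (measurableT_comp mf (measurable_cons measurable_fst measurable_snd)).
Qed.

Lemma meas_seq_cst n (c : \bar R) : meas_seq n (fun=> c).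
Proof.
by have := @measurable_cst _ _ (n.-tuple R) (\bar R) setT c.
Qed.

Lemma meas_seq_cons1 n f x : meas_seq n.+1 f -> meas_seq n (fun s => f (x :: s)).
Proof.
move=> mf.
have mc := measurable_cons (@measurable_cst _ _ (n.-tuple R) R setT x)
  (@measurable_id _ _ setT).
exact: (measurableT_comp mf mc).
Qed.

Lemma measurable_gauss_integrand m0 ms f : (forall s, 0 <= f s) ->
  meas_seq (size ms).+1 f ->
  measurable_fun setT (fun x : measurableTypeR R =>
    (normal_pdf m0 1 x)%:E * gauss_int ms (fun s => f (x :: s))).
Proof.
move=> f0 mf; apply: emeasurable_funM.
  by apply/measurable_EFinP; exact: measurable_normal_pdf.
apply: (@measurable_gauss_int _ _ ms (fun x s => f (x :: s))) => //.
exact: meas_seq_cons.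
Qed.

Lemma gauss_integrand_ge0 m0 ms f x : (forall s, 0 <= f s) ->
  0 <= (normal_pdf m0 1 x)%:E * gauss_int ms (fun s => f (x :: s)).
Proof.
move=> f0; apply: mule_ge0; first by rewrite lee_fin normal_pdf_ge0.
exact: gauss_int_ge0.
Qed.

Lemma le_gauss_int ms f g : (forall s, 0 <= f s) ->
  meas_seq (size ms) f -> meas_seq (size ms) g ->
  (forall s, f s <= g s) -> gauss_int ms f <= gauss_int ms g.
Proof.
elim: ms f g => [|m0 ms IH] f g f0 mf mg fg //=.
have g0 s : 0 <= g s by apply: le_trans (fg s).
apply: ge0_le_integral => //.
- by move=> x _; exact: gauss_integrand_ge0.
- exact: measurable_gauss_integrand.
- exact: measurable_gauss_integrand.
- move=> x _; apply: lee_wpmul2l; first by rewrite lee_fin normal_pdf_ge0.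
  by apply: IH => //; exact: meas_seq_cons1.
Qed.

Lemma gauss_intD ms f g : (forall s, 0 <= f s) -> (forall s, 0 <= g s) ->
  meas_seq (size ms) f -> meas_seq (size ms) g ->
  gauss_int ms (fun s => f s + g s) = gauss_int ms f + gauss_int ms g.
Proof.
elim: ms f g => [|m0 ms IH] f g f0 g0 mf mg //=.
rewrite -ge0_integralD//.
- apply: eq_integral => x _; rewrite IH//; try exact: meas_seq_cons1.
  by rewrite ge0_muleDr//; apply: gauss_int_ge0.
- by move=> x _; exact: gauss_integrand_ge0.
- exact: measurable_gauss_integrand.
- by move=> x _; exact: gauss_integrand_ge0.
- exact: measurable_gauss_integrand.
Qed.

Lemma gauss_intZ ms f (k : R) : (0 <= k)%R -> (forall s, 0 <= f s) ->
  meas_seq (size ms) f ->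
  gauss_int ms (fun s => k%:E * f s) = k%:E * gauss_int ms f.
Proof.
elim: ms f => [|m0 ms IH] f k0 f0 mf //=.
rewrite -ge0_integralZl//.
- apply: eq_integral => x _; rewrite IH//; last exact: meas_seq_cons1.
  by rewrite muleCA.
- exact: measurable_gauss_integrand.
- by move=> x _; exact: gauss_integrand_ge0.
Qed.

Lemma gauss_int_cst ms (k : R) : (0 <= k)%R -> gauss_int ms (fun=> k%:E) = k%:E.
Proof.
move=> k0; elim: ms => [|m0 ms IH] //=.
under eq_integral do rewrite IH muleC.
rewrite ge0_integralZl ?integral_normal_pdf ?mule1//.
- by apply/measurable_EFinP; exact: measurable_normal_pdf.
- by move=> x _; rewrite lee_fin normal_pdf_ge0.
Qed.

Lemma gauss_int_sum ms (I : Type) (r : seq I) (F : I -> seq R -> \bar R) :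
  (forall i s, 0 <= F i s) -> (forall i, meas_seq (size ms) (F i)) ->
  gauss_int ms (fun s => \sum_(i <- r) F i s) = \sum_(i <- r) gauss_int ms (F i).
Proof.
move=> F0 mF; elim: r => [|i r IH].
  rewrite big_nil -[RHS](@gauss_int_cst ms 0)//.
  by apply: eq_gauss_int => s _; rewrite big_nil.
rewrite big_cons -IH -gauss_intD//.
- by apply: eq_gauss_int => s _; rewrite big_cons.
- by move=> s; apply: sume_ge0.
- by apply: emeasurable_sum => j; exact: mF.
Qed.

(** * Exponential tilts and change of measure *)

Definition dot a s : R := (\sum_(z <- zip a s) z.1 * z.2)%R.

Lemma dot_cons (x : R) a (y : R) s : dot (x :: a) (y :: s) = (x * y + dot a s)%R.
Proof. by rewrite /dot big_cons. Qed.

Lemma dotC a s : dot a s = dot s a.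
Proof.
by elim: a s => [|x a IH] [|y s]; rewrite ?dot_cons ?IH 1?mulrC// /dot !big_nil.
Qed.

Lemma dot_map (I : Type) (r : seq I) (F G : I -> R) :
  dot (map F r) (map G r) = (\sum_(i <- r) F i * G i)%R.
Proof. by rewrite /dot zip_map big_map. Qed.

Lemma measurable_dot a n :
  measurable_fun setT (fun t : n.-tuple R => dot a (tval t)).
Proof.
elim: n a => [|n IH] a.
  rewrite (_ : (fun _ => _) = cst 0%R)//; apply/funext => t.
  by rewrite tuple0 /dot; case: a => [|x a]; rewrite big_nil.
case: a => [|x a].
  rewrite (_ : (fun _ => _) = cst 0%R)//; apply/funext => t.
  by rewrite /dot; case: (tval t) => [|? ?]; rewrite big_nil.
rewrite (_ : (fun _ => _) = (fun t : n.+1.-tuple R =>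
   x * thead t + dot a (tval [tuple of behead t]))%R); last first.
  by apply/funext => t; rewrite [in LHS](tuple_eta t) dot_cons.
apply: measurable_funD.
  apply: measurable_funM => //; exact: measurable_tnth.
have mb : measurable_fun setT (fun t : n.+1.-tuple R => [tuple of behead t]).
  exact: measurable_behead.
exact: (measurableT_comp (IH a) mb).
Qed.

(** Completing the square: an exponential tilt by [a] is a translation of the mean by [a], up to the
    moment generating function. *)
Lemma normal_pdf_tilt (m a x : R) :
  (normal_pdf m 1 x * expR (a * x) =
   expR (a * m + a ^+ 2 / 2) * normal_pdf (m + a) 1 x)%R.
Proof.
rewrite !normal_pdfE ?oner_neq0// mulrCA -!mulrA; congr (_ * _)%R.
by rewrite /normal_fun -!expRD; congr expR; field.
Qed.

Lemma gauss_int_exp ms a : size a = size ms ->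
  gauss_int ms (fun s => (expR (dot a s))%:E) =
  (expR (dot a ms + dot a a / 2))%:E.
Proof.
elim: ms a => [|m0 ms IH] [|x a]//= => [_|[sa]].
  by rewrite /dot !big_nil mul0r addr0.
rewrite (_ : (fun _ => _) = fun y =>
  (expR (dot (x :: a) (m0 :: ms) + dot (x :: a) (x :: a) / 2))%:E *
  (normal_pdf (m0 + x) 1 y)%:E).
  rewrite ge0_integralZl ?integral_normal_pdf ?mule1//.
  - by apply/measurable_EFinP; exact: measurable_normal_pdf.
  - by move=> y _; rewrite lee_fin normal_pdf_ge0.
apply/funext => y.
transitivity ((normal_pdf m0 1 y)%:E * ((expR (x * y))%:E *
   gauss_int ms (fun s => (expR (dot a s))%:E))).
  congr (_ * _); rewrite -gauss_intZ ?expR_ge0//.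
  - by apply: eq_gauss_int => s _; rewrite dot_cons expRD.
  - by apply/measurable_EFinP/measurableT_comp => //; exact: measurable_dot.
rewrite IH// -!EFinM mulrA normal_pdf_tilt mulrAC -expRD !dot_cons.
by congr ((expR _ * _)%R%:E); field.
Qed.

(** Density of the Gaussian law with mean vector [ms] with respect to the centred one. *)
Definition likelihood_ratio ms s : R := expR (dot ms s - dot ms ms / 2).

Lemma gauss_int_shift ms f : (forall s, 0 <= f s) -> meas_seq (size ms) f ->
  gauss_int ms f =
  gauss_int (nseq (size ms) 0%R) (fun s => (likelihood_ratio ms s)%:E * f s).
Proof.
elim: ms f => [|m0 ms IH] f f0 mf.
  by rewrite /= /likelihood_ratio /dot !big_nil mul0r subrr expR0 mul1e.
rewrite /=; apply: eq_integral => x _.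
transitivity ((normal_pdf 0 1 x)%:E * ((expR (m0 * x - m0 ^+ 2 / 2))%:E *
   gauss_int ms (fun s => f (x :: s)))).
  rewrite muleA -EFinM; congr (_%:E * _).
  rewrite expRD mulrA normal_pdf_tilt mulr0 !add0r mulrAC -expRD subrr expR0.
  by rewrite mul1r.
congr (_ * _); rewrite IH//; last exact: meas_seq_cons1.
rewrite -gauss_intZ ?expR_ge0//.
- apply: eq_gauss_int => s _; rewrite muleA -EFinM -expRD /likelihood_ratio !dot_cons.
  by congr ((expR _)%:E * _); field.
- by move=> s; rewrite mule_ge0// lee_fin expR_ge0.
- rewrite size_nseq; apply: emeasurable_funM; last exact: meas_seq_cons1.
  apply/measurable_EFinP/measurableT_comp => //.
  by apply: measurable_funB => //; exact: measurable_dot.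
Qed.

End GaussInt.

(** * The random path *)

Section RandomPath.
Variables S m : nat.
Hypothesis S_gt0 : (0 < S)%N.
Hypothesis m_le : (m <= 2 ^ S)%N.

(** The uniform finite probability space: one clock per pair (level, block), so that expectations
    are finite sums. All clocks share the range [2 ^ S]; level [s] only reads its clock modulo
    [2 ^ s], which is again uniform because [2 ^ s] divides [2 ^ S]. *)
Definition clocks : finType := {ffun 'I_S.+1 * 'I_m.+1 -> 'I_(2 ^ S)}.
Implicit Types (w : clocks) (k : 'I_S.+1 * 'I_m.+1) (c : 'I_(2 ^ S)).

(** [u %/ S] is the rank of [u] among the times of its level, and a block of level [s] holds [2 ^ s]
    consecutive ranks. *)
Definition cell (u : nat) : 'I_S.+1 * 'I_m.+1 :=
  (inord (u %% S), inord (u %/ S %/ 2 ^ (u %% S))).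

(* Time [u] belongs to level [s = u %% S]. Among the times of level [s], those
   of one block of length [S * 2 ^ s] go up until the clock of the block is
   exhausted, and down afterwards. *)
Definition up w (u : nat) : bool :=
  (u %/ S %% 2 ^ (u %% S) < w (cell u) %% 2 ^ (u %% S))%N.

Definition height w (t : nat) : nat := (\sum_(u < t) up w u)%N.

Definition reset w k c : clocks := [ffun x => if x == k then c else w x].

(** Resampling one clock preserves the uniform law: exchanging the fresh value [c] with the old
    value [w k] is an involution on pairs. *)
Lemma sum_reset (R : nmodType) k (f : clocks -> R) :
  \sum_w \sum_c f (reset w k c) = (\sum_w f w) *+ 2 ^ S.
Proof.
rewrite pair_big /=.
pose g (z : clocks * 'I_(2 ^ S)) := (reset z.1 k z.2, z.1 k).
have gK : involutive g.
  case=> w c; rewrite /g /= ffunE eqxx; congr pair; apply/ffunP => x.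
  by rewrite !ffunE; case: eqP => // ->.
rewrite (reindex_inj (inv_inj gK)) /=.
rewrite -(pair_bigA _ (fun w c => f (reset (reset w k c) k (w k)))) /=.
rewrite -sumrMnl; apply: eq_bigr => w _.
rewrite (eq_bigr (fun=> f w)); first by rewrite sumr_const card_ord.
move=> c _; congr f; apply/ffunP => x.
by rewrite !ffunE; case: eqP => // ->.
Qed.

Lemma up_reset w k c u : cell u != k -> up (reset w k c) u = up w u.
Proof. by move=> uk; rewrite /up ffunE (negbTE uk). Qed.

(** * Resampling the clock of one block *)

Section Block.
Variables s b : nat.
Hypotheses (sS : (s < S)%N) (bm : (b <= m)%N).
Let k : 'I_S.+1 * 'I_m.+1 := (inord s, inord b).
Let L := (S * 2 ^ s)%N.

Lemma cell_block u : (u <= m)%N -> cell u = k -> (u %% S = s)%N /\ (u %/ S %/ 2 ^ s = b)%N.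
Proof.
move=> um [/(congr1 val)] /=; rewrite !inordK ?ltnS//; last 2 first.
- by rewrite ltnW.
- by rewrite ltnW// ltn_mod.
move=> us /(congr1 val) /=; rewrite !inordK ?ltnS// ?us//.
by rewrite (leq_trans (leq_div _ _))// (leq_trans (leq_div _ _)).
Qed.

Lemma height_reset_before w c t : (t <= m)%N -> (t <= b * L)%N ->
  height (reset w k c) t = height w t.
Proof.
move=> tm tb; apply: eq_bigr => u _; rewrite up_reset//.
apply/eqP => /cell_block[|us ub]; first by rewrite ltnW// (leq_trans (ltn_ord u)).
have ut := ltn_ord u.
have: (b * 2 ^ s <= u %/ S)%N by rewrite -ub leq_divM.
rewrite leq_divRL// => h.
by move: (leq_trans ut tb); rewrite /L; nia.
Qed.

(** Raising the clock turns no up-step into a down-step, and it gains the step at time [u0], whose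
    rank within the block is [c %% 2 ^ s]. *)
Lemma height_reset_lt w c c' t : (t <= m)%N -> (b.+1 * L <= t)%N ->
  (c %% 2 ^ s < c' %% 2 ^ s)%N ->
  (height (reset w k c) t < height (reset w k c') t)%N.
Proof.
move=> tm bt cc'.
have s0 : (0 < 2 ^ s)%N by rewrite expn_gt0.
have lec : (c %% 2 ^ s < 2 ^ s)%N by rewrite ltn_mod.
set r := (c %% 2 ^ s)%N in cc' lec.
pose u0 := ((b * 2 ^ s + r) * S + s)%N.
have u0t : (u0 < t)%N by move: bt; rewrite /u0 /L; nia.
have u0s : (u0 %% S = s)%N by rewrite /u0 modnMDl modn_small.
have u0d : (u0 %/ S = b * 2 ^ s + r)%N by rewrite /u0 divnMDl// divn_small// addn0.
have u0k : cell u0 = k.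
  by rewrite /cell u0s u0d divnMDl// divn_small// addn0.
have upk (u : 'I_t) (d : 'I_(2 ^ S)) :
    up (reset w k d) u = if cell u == k then (u %/ S %% 2 ^ s < d %% 2 ^ s)%N
                         else up w u.
  case: eqP => [uk|/eqP/up_reset//].
  have [|us ub] := cell_block _ uk; first by rewrite ltnW// (leq_trans (ltn_ord u)).
  by rewrite /up us ffunE uk eqxx.
rewrite /height (bigD1 (Ordinal u0t))//= [ltnRHS](bigD1 (Ordinal u0t))//=.
rewrite (upk (Ordinal u0t)) (upk (Ordinal u0t)) /= u0k eqxx u0d.
rewrite modnMDl (modn_small lec) -/r ltnn cc' add0n add1n ltnS.
apply: leq_sum => u _; rewrite !upk; case: ifP => // _.
by case: ltnP => // h; rewrite (ltn_trans h cc').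
Qed.

(** By strict monotonicity the height determines [c %% 2 ^ s], so [c] is determined by its quotient
    by [2 ^ s], which takes at most [2 ^ (S - s)] values. *)
Lemma card_height_reset w t x : (t <= m)%N -> (b.+1 * L <= t)%N ->
  (#|[pred c | height (reset w k c) t == x]| <= 2 ^ (S - s))%N.
Proof.
move=> tm bt; rewrite -[leqRHS]card_ord.
have s0 : (0 < 2 ^ s)%N by rewrite expn_gt0.
have lt_div c : (c %/ 2 ^ s < 2 ^ (S - s))%N.
  by rewrite ltn_divLR// -expnD subnK// ltnW.
apply: (@leq_card_in _ _ (fun c => Ordinal (lt_div c))) => c c'.
rewrite !inE => /eqP hc /eqP hc' /(congr1 val) /= dd.
apply: val_inj => /=; rewrite (divn_eq c (2 ^ s)) (divn_eq c' (2 ^ s)) dd.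
congr (_ + _)%N; case: (ltngtP (c %% 2 ^ s) (c' %% 2 ^ s)) => // h.
- by have := height_reset_lt w tm bt h; rewrite hc hc' ltnn.
- by have := height_reset_lt w tm bt h; rewrite hc hc' ltnn.
Qed.

End Block.

(** With [2 ^ s] the largest power of two below [(t - i) / (2 S)], the block length [L] is at most
    half the lag, so an aligned block fits between [i] and [t], while the lag stays below [4 L]. *)
Lemma block_between i t : (i < t)%N -> (t < m)%N -> (2 * S <= t - i)%N ->
  exists s b, [/\ (s < S)%N, (b <= m)%N, (i <= b * (S * 2 ^ s))%N,
    (b.+1 * (S * 2 ^ s) <= t)%N & (t - i <= 4 * S * 2 ^ s)%N].
Proof.
move=> it tm lag; pose q := ((t - i) %/ (2 * S))%N.
have q0 : (0 < q)%N by rewrite divn_gt0// muln_gt0.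
pose s := trunc_log 2 q; exists s.
have /andP[sq qs] := trunc_log_bounds (isT : (1 < 2)%N) q0.
rewrite -/s in sq qs.
have s1 : (2 ^ s * (2 * S) <= t - i)%N.
  by rewrite (leq_trans _ (leq_divM (t - i) (2 * S)))// leq_mul2r sq orbT.
have s2 : (t - i < 2 ^ s.+1 * (2 * S))%N by rewrite -ltn_divLR// muln_gt0.
have s0 : (0 < 2 ^ s)%N by rewrite expn_gt0.
set L := (S * 2 ^ s)%N; have L0 : (0 < L)%N by rewrite muln_gt0 S_gt0.
(* The ceiling of [i / L]: the first block that starts at time [i] or later. *)
pose b := ((i + L.-1) %/ L)%N; exists b.
have b1 : (b * L <= i + L.-1)%N := leq_divM _ _.
have b2 : (i + L.-1 < b.+1 * L)%N by rewrite ltn_ceil.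
have sm : (s < S)%N.
  rewrite -(ltn_exp2l s S (isT : (1 < 2)%N)) (leq_trans _ m_le)//.
  by move: s1 tm; nia.
rewrite expnS in s2; split => //; rewrite -?/L.
- have : (b * 1 <= b * L)%N by rewrite leq_mul2l L0 orbT.
  by move: s1; rewrite /L; nia.
- by move: b2; rewrite mulSn; lia.
- by move: b1 s1; rewrite mulSn /L; lia.
- by move: s2; nia.
Qed.

(** * Hitting a prescribed trajectory *)

Section Hitting.
Variables (R : realFieldType) (x : nat -> nat).

Definition hit w t : bool := height w t == x t.

(** Measurability with respect to the past of the walk up to time [i]. *)
Definition adapted i (f : clocks -> R) :=
  forall w w', (forall u, (u <= i)%N -> height w u = height w' u) -> f w = f w'.

(** In conditional form: given the past up to [i], the height at time [t] equals [x t] with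
    probability at most [4 S / (t - i)]. *)
Lemma sum_hit_le i t (f : clocks -> R) : (i < t)%N -> (t < m)%N ->
  (forall w, 0 <= f w) -> adapted i f ->
  \sum_w f w * (hit w t)%:R <= 4 * S%:R / (t - i)%:R * \sum_w f w.
Proof.
move=> it tm f0 fi.
have ti0 : 0 < (t - i)%:R :> R by rewrite ltr0n subn_gt0.
have sf0 : 0 <= \sum_w f w by apply: sumr_ge0.
(* For a short lag the factor [4 S / (t - i)] exceeds 1 and the bound is trivial. *)
have [lag|lag] := ltnP (t - i) (2 * S).
  apply: (@le_trans _ _ (\sum_w f w)).
    by apply: ler_sum => w _; rewrite ler_piMr// lern1; case: (hit _ _).
  rewrite ler_peMl// ler_pdivlMr// mul1r -natrM ler_nat.
  by rewrite (leq_trans (ltnW lag))// leq_mul2r orbT.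
have [s [b [sS bm ib bt ts]]] := block_between it tm lag.
pose k : 'I_S.+1 * 'I_m.+1 := (inord s, inord b).
have im : (i <= m)%N by rewrite ltnW// (ltn_trans it tm).
have M0 : 0 < (2 ^ S)%:R :> R by rewrite ltr0n expn_gt0.
have s0 : 0 < (2 ^ s)%:R :> R by rewrite ltr0n expn_gt0.
apply: (@le_trans _ _ ((2 ^ s)%:R^-1 * \sum_w f w)); last first.
  rewrite ler_wpM2r// ler_pdivlMr// mulrC ler_pdivrMr// -!natrM ler_nat.
  exact: ts.
(* Average over a fresh clock for the block between [i] and [t]: the weight [f] does not see it, and
   at most [2 ^ (S - s)] of its [2 ^ S] values produce a hit. *)
rewrite -(ler_pM2l M0) mulr_natl -(sum_reset k) mulrCA !mulr_sumr.
apply: ler_sum => w _.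
rewrite (eq_bigr (fun c => f w * (height (reset w k c) t == x t)%:R)); last first.
  move=> c _; congr (_ * _); apply: fi => u ui.
  by apply: height_reset_before => //; [exact: leq_trans im|exact: leq_trans ib].
rewrite -mulr_sumr mulrA [leRHS]mulrC ler_wpM2l// ler_pdivlMl//.
rewrite -natr_sum -natrM ler_nat.
rewrite (eq_bigr (fun c => if height (reset w k c) t == x t then 1 else 0)%N).
  rewrite -big_mkcond /= sum1_card.
  apply: (@leq_trans (2 ^ s * 2 ^ (S - s))); last by rewrite -expnD subnKC// ltnW.
  by rewrite leq_mul2l (card_height_reset sS bm) ?orbT// ltnW.
by move=> c _; case: eqP.
Qed.

(** Expand the product and group the terms by the first index [t] at which [g t] is chosen instead
    of 1. *)
Lemma prodrD1_expand (g : nat -> R) j n :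
  \prod_(j <= t < n) (1 + g t) =
  1 + \sum_(j <= t < n) g t * \prod_(t.+1 <= u < n) (1 + g u).
Proof.
have [nj|jn] := leqP n j; first by rewrite !big_geq// addr0.
move: jn; rewrite -subn_gt0; move E : (n - j)%N => d.
elim: d j E => // d IH j E _.
have jn : (j < n)%N by rewrite -subn_gt0 E.
rewrite (big_ltn jn) [in RHS](big_ltn jn) mulrDl mul1r addrA [RHS]addrAC.
congr (_ + _); case: d IH E => [|d] IH E.
  by rewrite !big_geq ?addr0//; lia.
by rewrite IH//; lia.
Qed.

(* Expanding the product along the next hit, [sum_hit_le] bounds each step by
   the next term of a geometric series of ratio [a * Theta]. *)
Lemma sum_prod_hit_le (a C : R) :
  let Theta := 4 * S%:R * \sum_(1 <= k < m) k%:R^-1 in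
  0 <= a -> 0 <= C -> 1 + a * Theta * C <= C ->
  forall i (f : clocks -> R), (forall w, 0 <= f w) -> adapted i f ->
  \sum_w f w * \prod_(i.+1 <= t < m) (1 + a * (hit w t)%:R)
    <= C * \sum_w f w.
Proof.
move=> Theta a0 C0 aC i; move E : (m - i)%N => d.
elim/ltn_ind: d i E => d IH i E f f0 fi.
have sf0 : 0 <= \sum_w f w by apply: sumr_ge0.
apply: (@le_trans _ _ ((1 + a * Theta * C) * \sum_w f w)); last first.
  by rewrite ler_wpM2r.
under eq_bigr do rewrite prodrD1_expand mulrDr mulr1 mulr_sumr.
rewrite big_split /= mulrDl mul1r lerD2l exchange_big /=.
apply: (@le_trans _ _ (\sum_(i.+1 <= t < m)
    a * C * (4 * S%:R / (t - i)%:R * \sum_w f w))).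
  rewrite big_nat [leRHS]big_nat; apply: ler_sum => t /andP[it tm].
  rewrite (eq_bigr (fun w => a * (f w * (hit w t)%:R *
    \prod_(t.+1 <= u < m) (1 + a * (hit w u)%:R)))); last first.
    by move=> w _; ring.
  rewrite -mulr_sumr -mulrA ler_wpM2l//.
  (* The weight [f w * (hit w t)%:R] is adapted at time [t], so the induction hypothesis at [t]
     replaces the later factors by [C]. *)
  apply: (le_trans (IH (m - t)%N _ t erefl _ _ _)); first by lia.
  - by move=> w; rewrite mulr_ge0.
  - move=> w w' ww'; rewrite /hit ww'//; congr (_ * _).
    by apply: fi => u ui; apply: ww'; rewrite (leq_trans ui)// ltnW.
  - by rewrite ler_wpM2l// sum_hit_le.
rewrite -mulr_sumr -mulr_suml -mulrA [a * Theta * C]mulrAC -[leRHS]mulrA.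
rewrite mulrA ler_wpM2l ?mulr_ge0// ler_wpM2r// /Theta -mulr_sumr.
rewrite ler_wpM2l ?mulr_ge0//.
have [mi|im] := leqP m i.+1; first by rewrite big_geq// sumr_ge0.
rewrite -{1}[i.+1]addn1 addnC big_addn.
rewrite (eq_bigr (fun t => t%:R^-1)); last by move=> t _; rewrite addnK.
rewrite [leRHS](@big_cat_nat _ _ _ (m - i))/= ?leq_subr//; last by lia.
by rewrite lerDl sumr_ge0.
Qed.

(** Time 0 has no past to condition on, so its factor is bounded by [1 + a], and the constant
    [1 + a] serves as the weight adapted at time 0. *)
Lemma sum_prod_hit (a C : R) : (0 < m)%N ->
  let Theta := 4 * S%:R * \sum_(1 <= k < m) k%:R^-1 in
  0 <= a -> 0 <= C -> 1 + a * Theta * C <= C ->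
  \sum_w \prod_(t < m) (1 + a * (hit w t)%:R) <= (1 + a) * C * #|clocks|%:R.
Proof.
move=> m0 Theta a0 C0 aC.
apply: (@le_trans _ _ (\sum_w (1 + a) *
    \prod_(1 <= t < m) (1 + a * (hit w t)%:R))).
  apply: ler_sum => w _; rewrite -(big_mkord xpredT (fun t => 1 + a * (hit w t)%:R)).
  rewrite big_ltn// ler_wpM2r//.
    by apply: prodr_ge0 => t _; rewrite addr_ge0// mulr_ge0.
  by rewrite lerD2l ler_piMr// lern1; case: (hit _ _).
apply: (le_trans (sum_prod_hit_le a0 C0 aC (i := 0) _ _)) => //.
- by move=> w; rewrite addr_ge0.
- have -> : \sum_(w : clocks) (1 + a) = (1 + a) *+ #|clocks| by rewrite sumr_const.
  by rewrite -mulr_natr mulrCA mulrA.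
Qed.

End Hitting.
End RandomPath.

(** * Chernoff bound and second moment method *)

Section Tests.
Context {R : realType}.
Implicit Types (ms a s : seq R).

Lemma to_tuple_val n (t : n.-tuple R) : to_tuple n (tval t) = t.
Proof. by apply: val_inj; rewrite val_insubd size_tuple eqxx. Qed.

Lemma val_to_tuple n s : size s = n -> tval (to_tuple n s) = s.
Proof. by move=> <-; rewrite val_insubd eqxx. Qed.

Lemma meas_seq_test n (T : n.-tuple R -> bool) : measurable_fun setT T ->
  meas_seq n (fun s => ((T (to_tuple n s))%:R)%:E).
Proof.
move=> mT; rewrite /meas_seq.
rewrite (_ : _ \o _ = EFin \o ((fun b : bool => b%:R) \o T)); last first.
  by apply/funext => t /=; rewrite to_tuple_val.
by apply/measurable_EFinP; apply: measurableT_comp.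
Qed.

Lemma measurable_negb_test n (T : n.-tuple R -> bool) : measurable_fun setT T ->
  measurable_fun setT (fun x => ~~ T x).
Proof. by move=> mT; apply: measurableT_comp. Qed.

Lemma measurable_dot_test n a (c : R) :
  measurable_fun setT (fun t : n.-tuple R => c < dot a (tval t)).
Proof. by apply: measurable_fun_ltr => //; exact: measurable_dot. Qed.

Lemma dotNl a s : dot (map -%R a) s = - dot a s.
Proof.
elim: a s => [|x a IH] [|y s]; rewrite ?dot_cons ?IH ?mulNr ?opprD//.
all: by rewrite /dot /= !big_nil oppr0.
Qed.

Lemma dot0r a n : dot a (nseq n 0) = 0.
Proof.
elim: a n => [|x a IH] [|n]; rewrite ?dot_cons ?IH ?mulr0 ?addr0//.
all: by rewrite /dot /= !big_nil.
Qed.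

(** Exponential Markov inequality: the indicator of [f] is at most [expR (dot a s + c)], whose
    integral is explicit. *)
Lemma gauss_int_chernoff ms a (c : R) (f : seq R -> bool) : size a = size ms ->
  meas_seq (size ms) (fun s => ((f s)%:R)%:E) ->
  (forall s, f s -> 0 <= dot a s + c) ->
  (gauss_int ms (fun s => ((f s)%:R)%:E)
    <= (expR (dot a ms + dot a a / 2 + c))%:E)%E.
Proof.
move=> sa mf fa.
have mexp : meas_seq (size ms) (fun s => (expR (dot a s))%:E).
  by apply/measurable_EFinP/measurableT_comp => //; exact: measurable_dot.
rewrite expRD mulrC EFinM -gauss_int_exp// -gauss_intZ ?expR_ge0//.
apply: le_gauss_int => //.
  exact: measurable_funeM.
move=> s; rewrite -EFinM lee_fin -expRD addrC; case: (boolP (f s)) => [/fa h|_].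
  by rewrite (le_trans _ (expR_ge1Dx _))// lerDl.
exact: expR_ge0.
Qed.

(* With [L] the average likelihood ratio, [T + (1 - T) L >= min 1 L >= 1 - |L - 1|
   >= 1 - e - (L - 1) ^ 2 / (4 e)]. The proof integrates this inequality with
   the negative terms moved to the other side, so that only nonnegative
   functions are integrated. *)
Lemma average_risk_ge (I : finType) n (ms : I -> seq R) (T : n.-tuple R -> bool)
    (e K : R) : (0 < #|I|)%N -> (forall i, size (ms i) = n) -> 0 < e ->
  measurable_fun setT T ->
  \sum_i \sum_j expR (dot (ms i) (ms j)) <= K * #|I|%:R ^+ 2 ->
  ((1 - e - (K - 1) / (4 * e))%:E <=
    prob_reject (nseq n 0%R) T +
    ((#|I|%:R)^-1)%:E * \sum_i prob_reject (ms i) (fun x => ~~ T x))%E.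
Proof.
move=> I0 sms e0 mT hK.
have N0 : 0 < #|I|%:R :> R by rewrite ltr0n.
have N0' : #|I|%:R != 0 :> R by rewrite gt_eqF.
set N : R := #|I|%:R in hK N0 N0' *.
have V0 : 0 <= N^-1 by rewrite invr_ge0 ltW.
pose l i s := likelihood_ratio (ms i) s.
have l0 i s : 0 <= l i s by rewrite expR_ge0.
pose L s := N^-1 * \sum_i l i s.
have L0 s : 0 <= L s by rewrite mulr_ge0// sumr_ge0.
have ml i : measurable_fun setT (fun t : n.-tuple R => l i (tval t)).
  by apply: measurableT_comp => //; apply: measurable_funB => //; exact: measurable_dot.
have mL : measurable_fun setT (fun t : n.-tuple R => L (tval t)).
  by apply: measurable_funM => //; apply: measurable_sum => i; exact: ml.
pose z := nseq n (0 : R).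
have sz : size z = n by rewrite size_nseq.
pose Tf s : R := (T (to_tuple n s))%:R.
pose Tg s : R := (~~ T (to_tuple n s))%:R.
have mTf : meas_seq n (fun s => (Tf s)%:E) by exact: meas_seq_test.
have mTg : meas_seq n (fun s => (Tg s)%:E).
  exact: (meas_seq_test (measurable_negb_test mT)).
have mLE : meas_seq n (EFin \o L) by apply/measurable_EFinP.
have Tf0 s : 0 <= Tf s by [].
have Tg0 s : 0 <= Tg s by [].
have TL0 s : 0 <= Tg s * L s by exact: mulr_ge0.
have L20 s : 0 <= L s ^+ 2 by exact: sqr_ge0.
have E1 i : gauss_int z (fun s => (l i s)%:E) = 1%E.
  rewrite -(@gauss_int_cst _ (ms i) 1)// [RHS]gauss_int_shift//; last first.
    exact: meas_seq_cst.
  by rewrite sms; apply: eq_gauss_int => s _; rewrite mule1.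
have EL : gauss_int z (EFin \o L) = 1%E.
  rewrite (_ : EFin \o L = fun s => ((N^-1)%:E * \sum_i (l i s)%:E)%E); last first.
    by apply/funext => s /=; rewrite sumEFin EFinM.
  rewrite gauss_intZ//; first last.
  - by rewrite sz; apply: emeasurable_sum => i; apply/measurable_EFinP; exact: ml.
  - by move=> s; apply: sume_ge0 => i _; rewrite lee_fin.
  rewrite gauss_int_sum ?sz; first last.
  - by move=> i; apply/measurable_EFinP; exact: ml.
  - by move=> i s; rewrite lee_fin.
  under eq_bigr do rewrite E1.
  by rewrite sumEFin -EFinM sumr_const -/N mulVf.
(* Change of measure: the average type II error is the null expectation of [(1 - T) L]. *)
have ETg : gauss_int z (fun s => (Tg s * L s)%:E) =
    ((N^-1)%:E * \sum_i prob_reject (ms i) (fun x => ~~ T x))%E.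
  rewrite (_ : (fun _ => _) =
      fun s => ((N^-1)%:E * \sum_i ((l i s)%:E * (Tg s)%:E))%E); last first.
    apply/funext => s; under eq_bigr do rewrite -EFinM.
    by rewrite sumEFin -EFinM -mulr_suml /L; congr (_%:E); ring.
  have mlT i : meas_seq n (fun s => ((l i s)%:E * (Tg s)%:E)%E).
    by apply: emeasurable_funM => //; apply/measurable_EFinP; exact: ml.
  rewrite gauss_intZ//; first last.
  - by rewrite sz; apply: emeasurable_sum => i; exact: mlT.
  - by move=> s; apply: sume_ge0 => i _; rewrite mule_ge0// lee_fin.
  congr (_ * _)%E; rewrite gauss_int_sum ?sz//; last first.
    by move=> i s; rewrite mule_ge0// lee_fin.
  apply: eq_bigr => i _; rewrite /prob_reject [RHS]gauss_int_shift ?sms//.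
(* The null expectation of [l i * l j] is [expR (dot (ms i) (ms j))]: absorbing [l i] moves the mean
   to [ms i], where [l j] has an explicit exponential moment. *)
have EL2 : (gauss_int z (fun s => (L s ^+ 2)%:E) <= K%:E)%E.
  have mll i j : meas_seq n (fun s => ((l i s)%:E * (l j s)%:E)%E).
    by apply: emeasurable_funM; apply/measurable_EFinP; exact: ml.
  have ll0 i j s : (0 <= (l i s)%:E * (l j s)%:E)%E by rewrite mule_ge0// lee_fin.
  have -> : gauss_int z (fun s => (L s ^+ 2)%:E) =
      ((N^-1 ^+ 2 * \sum_i \sum_j expR (dot (ms i) (ms j)))%:E)%E.
    rewrite (_ : (fun _ => _) = fun s => ((N^-1 ^+ 2)%:E *
        \sum_i \sum_j ((l i s)%:E * (l j s)%:E))%E); last first.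
      apply/funext => s.
      under eq_bigr do (under eq_bigr do rewrite -EFinM; rewrite sumEFin).
      rewrite sumEFin -EFinM /L exprMn; congr (_ * _)%R%:E.
      by rewrite expr2 mulr_suml; apply: eq_bigr => i _; rewrite mulr_sumr.
    rewrite gauss_intZ ?exprn_ge0// ?sz; first last.
    - by apply: emeasurable_sum => i; apply: emeasurable_sum => j; exact: mll.
    - by move=> s; apply: sume_ge0 => i _; apply: sume_ge0 => j _.
    rewrite [RHS]EFinM; congr (_ * _)%E; rewrite -sumEFin gauss_int_sum ?sz; first last.
    - by move=> i; apply: emeasurable_sum => j; exact: mll.
    - by move=> i s; apply: sume_ge0 => j _.
    apply: eq_bigr => i _; rewrite -sumEFin gauss_int_sum ?sz//.
    apply: eq_bigr => j _.
    transitivity (gauss_int (ms i) (fun s => (l j s)%:E)).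
      rewrite [RHS]gauss_int_shift ?sms//; last by apply/measurable_EFinP; exact: ml.
      by move=> s; rewrite lee_fin.
    transitivity (gauss_int (ms i) (fun s =>
        ((expR (- (dot (ms j) (ms j) / 2)))%:E * (expR (dot (ms j) s))%:E)%E)).
      by apply: eq_gauss_int => s _; rewrite -EFinM -expRD addrC.
    rewrite gauss_intZ ?expR_ge0//; last first.
      by rewrite sms; apply/measurable_EFinP/measurableT_comp => //; exact: measurable_dot.
    rewrite gauss_int_exp ?sms// -EFinM -expRD dotC.
    by congr (expR _)%:E; ring.
  by rewrite lee_fin exprVn mulrC ler_pdivrMr ?exprn_gt0.
pose c := e + (4 * e)^-1.
have c0 : 0 <= c by rewrite addr_ge0 ?invr_ge0 ?mulr_ge0// ltW.
have d0 : 0 <= (4 * e)^-1 by rewrite invr_ge0 mulr_ge0// ltW.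
have b0 : 0 <= (2 * e)^-1 by rewrite invr_ge0 mulr_ge0// ltW.
have pointwise s : 1 + (2 * e)^-1 * L s <=
    ((Tf s + Tg s * L s) + (4 * e)^-1 * L s ^+ 2) + c.
  have e4 : (2 * e)^-1 = 2 * (4 * e)^-1.
    by field; rewrite gt_eqF.
  have e5 : e * (4 * e)^-1 = 1 / 4 by field; rewrite gt_eqF.
  (* The difference of the two sides is [e + (L - 1) ^ 2 / (4 e)] when the test rejects, and
     [(L - 1 + 2 e) ^ 2 / (4 e)] when it accepts. *)
  rewrite /Tf /Tg /c e4; case: (T _) => /=; rewrite ?mul0r ?mul1r ?addr0 ?add0r.
    rewrite -subr_ge0.
    have -> : 1 + (4 * e)^-1 * L s ^+ 2 + (e + (4 * e)^-1) - (1 + 2 * (4 * e)^-1 * L s)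
      = e + (4 * e)^-1 * (L s - 1) ^+ 2 by ring.
    by apply: addr_ge0; [exact: ltW|exact: mulr_ge0 (sqr_ge0 _)].
  rewrite -subr_ge0.
  have -> : L s + (4 * e)^-1 * L s ^+ 2 + (e + (4 * e)^-1) - (1 + 2 * (4 * e)^-1 * L s)
      = (4 * e)^-1 * (L s - 1 + 2 * e) ^+ 2
        + (1 - 4 * (e * (4 * e)^-1)) * (L s - 1 + e) by field; rewrite gt_eqF.
  rewrite e5 (_ : 1 - 4 * (1 / 4) = 0) ?mul0r ?addr0; last by field.
  exact: mulr_ge0 (sqr_ge0 _).
have mTL : meas_seq n (fun s => (Tg s * L s)%:E).
  by under eq_fun do rewrite EFinM; exact: emeasurable_funM.
have mL2 : meas_seq n (fun s => (L s ^+ 2)%:E).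
  by apply/measurable_EFinP; exact: measurable_funX.
have lhs : gauss_int z (fun s => (1%:E + ((2 * e)^-1)%:E * (L s)%:E)%E) =
    (1 + (2 * e)^-1)%:E.
  rewrite gauss_intD// ?sz ?gauss_int_cst//; last first.
  - exact: measurable_funeM.
  - exact: meas_seq_cst.
  - by move=> s; rewrite mule_ge0// lee_fin.
  rewrite gauss_intZ// ?sz//.
  by rewrite (_ : gauss_int z _ = 1%E)// mule1.
have rhs : gauss_int z (fun s => ((((Tf s)%:E + (Tg s * L s)%:E)
      + ((4 * e)^-1)%:E * (L s ^+ 2)%:E) + c%:E)%E) =
    (prob_reject z T + (N^-1)%:E * (\sum_i prob_reject (ms i) (fun x => ~~ T x))
      + ((4 * e)^-1)%:E * gauss_int z (fun s => (L s ^+ 2)%:E) + c%:E)%E.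
  rewrite gauss_intD//; first last.
  - exact: meas_seq_cst.
  - rewrite sz; apply: emeasurable_funD; last exact: measurable_funeM.
    exact: emeasurable_funD.
  - by move=> s; rewrite !adde_ge0 ?mule_ge0 ?lee_fin.
  rewrite gauss_int_cst// gauss_intD ?sz//; first last.
  - exact: measurable_funeM.
  - exact: emeasurable_funD.
  - by move=> s; rewrite mule_ge0 ?lee_fin.
  - by move=> s; rewrite adde_ge0 ?lee_fin.
  by rewrite gauss_intZ ?sz// gauss_intD ?sz// ETg.
have main : ((1 + (2 * e)^-1)%:E <=
    prob_reject z T + (N^-1)%:E * (\sum_i prob_reject (ms i) (fun x => ~~ T x))
      + ((4 * e)^-1)%:E * K%:E + c%:E)%E.
  rewrite -lhs; apply: (@le_trans _ _ (gauss_int z (fun s => ((((Tf s)%:E +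
    (Tg s * L s)%:E) + ((4 * e)^-1)%:E * (L s ^+ 2)%:E) + c%:E)%E))).
    apply: le_gauss_int; rewrite ?sz.
    - by move=> s; rewrite -EFinM -EFinD lee_fin addr_ge0// mulr_ge0.
    - by apply: emeasurable_funD; [exact: meas_seq_cst|exact: measurable_funeM].
    - apply: emeasurable_funD; last exact: meas_seq_cst.
      by apply: emeasurable_funD; [exact: emeasurable_funD|exact: measurable_funeM].
    - by move=> s; rewrite -!EFinM -!EFinD lee_fin; exact: pointwise.
  rewrite rhs leeD2r// leeD2l// lee_wpmul2l// lee_fin.
move: main; rewrite -EFinM -addeA -EFinD -leeBlDr// -EFinB; apply: le_trans.
rewrite lee_fin /c le_eqVlt; apply/orP; left; apply/eqP.
by field; rewrite gt_eqF.
Qed.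

End Tests.

(** * Detection on the lattice *)

Section Lattice.
Variable R : realType.

(** Parity and range of the position are what is needed to view it as a vertex of the lattice. *)
Lemma path_even m p i : is_path m p -> (i < m)%N ->
  exists2 k, (k <= i)%N & nth 0 p i = (2 * k)%:Z - i%:Z.
Proof.
move=> [_ [p0 pS]]; elim: i => [|i IH] im; first by exists 0%N.
have [k ki pk] := IH (ltnW im).
have /eqP := pS _ im; rewrite eqr_norml => /andP[/orP[] /eqP d _].
- by exists k.+1; [rewrite ltnS|move: d pk; lia].
- by exists k; [rewrite leqW|move: d pk; lia].
Qed.

Lemma path_vertex m p (t : 'I_m) : is_path m p ->
  exists v : vert m, (sval v).1 = t /\ on_path p v.
Proof.
move=> pp; have [k kt pk] := path_even pp (ltn_ord t).
exists (exist _ (t, Ordinal (leq_ltn_trans kt (ltn_ord t))) kt); split => //.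
by rewrite /on_path /vcol /vrow /= pk.
Qed.

Lemma on_path_inj m p (v v' : vert m) : on_path p v -> on_path p v' ->
  (sval v).1 = (sval v').1 -> v = v'.
Proof.
rewrite /on_path /vcol /vrow => /eqP h /eqP h' e.
apply: val_inj; apply: injective_projections => //; apply: val_inj => /=.
move: h h'; rewrite e => -> /addIr [] /eqP; rewrite eqn_mul2l => /eqP; apply.
Qed.

(** A path meets each row in exactly one vertex, so its vertices are in bijection with the rows. *)
Lemma sum_on_path m p (F : nat -> R) : is_path m p ->
  \sum_(v : vert m | on_path p v) F (vrow v) = \sum_(t < m) F t.
Proof.
move=> pp; have [h hP] := choice (fun t : 'I_m => path_vertex t pp).
rewrite (reindex_onto h (fun v => (sval v).1)) /=; last first.
  by move=> v pv; have [h1 h2] := hP (sval v).1; exact: on_path_inj h2 pv h1.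
by apply: eq_big => t; have [h1 h2] := hP t; rewrite ?h2 /vrow h1 ?eqxx.
Qed.

Lemma sum_row_le m (F : nat -> R) : (forall t, 0 <= F t) ->
  \sum_(v : vert m) F (vrow v) <= \sum_(t < m) t.+1%:R * F t.
Proof.
move=> F0; rewrite (partition_big (fun v : vert m => (sval v).1) predT)//=.
apply: ler_sum => t _.
rewrite (eq_bigr (fun=> F t)); last by move=> v /eqP <-.
rewrite sumr_const -[leLHS]mulr_natl ler_wpM2r// ler_nat.
rewrite -[leqRHS]card_ord.
pose f (v : vert m) : 'I_t.+1 := inord (val (sval v).2).
apply: (@leq_card_in _ _ f) => v v'; rewrite !unfold_in => /eqP vt /eqP vt'.
have le2 (u : vert m) : val (sval u).1 = val t -> (val (sval u).2 < t.+1)%N.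
  by move=> ut; rewrite ltnS; move: (valP u); rewrite ut.
move=> /(congr1 val); rewrite /f /= !inordK ?le2// => e.
apply: val_inj; apply: injective_projections.
  by apply: val_inj; rewrite vt vt'.
exact: val_inj.
Qed.

(** * Harmonic numbers and the logarithm *)

Definition harm n : R := \sum_(t < n) t.+1%:R^-1.

(** Both bounds are [ln (1 + x) <= x], taken at [x = 1 / (n + 1)] and at [x = - 1 / (n + 2)]. *)
Lemma ln_succ_diff n : 
  (n.+2%:R)^-1 <= ln (n.+2%:R : R) - ln n.+1%:R <= n.+1%:R^-1.
Proof.
have n1 : 0 < n.+1%:R :> R by rewrite ltr0n.
have n2 : 0 < n.+2%:R :> R by rewrite ltr0n.
have e1 : n.+2%:R = n.+1%:R + 1 :> R by rewrite natr1.
rewrite -ln_div ?posrE//; apply/andP; split; last first.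
  rewrite (_ : _ / _ = 1 + n.+1%:R^-1); last first.
    by rewrite e1; field; rewrite gt_eqF.
  by rewrite le_ln1Dx// (lt_trans (ltrN10 _))// invr_gt0.
rewrite -[leRHS]opprK -lnV ?posrE ?divr_gt0// lerNr invf_div.
rewrite (_ : _ / _ = 1 + - n.+2%:R^-1); last first.
  by rewrite -[X in X / _](addrK 1) natr1 mulrBl divff ?gt_eqF// mul1r.
by rewrite le_ln1Dx// ltrN2 invf_lt1// ltr1n.
Qed.

Lemma ln_le_harm n : ln n.+1%:R <= harm n.+1.
Proof.
apply: (@le_trans _ _ (harm n)); last by rewrite /harm big_ord_recr lerDl.
elim: n => [|n IH]; first by rewrite ln1 /harm big_ord0.
rewrite /harm big_ord_recr /=.
by rewrite -[leLHS](subrKC (ln n.+1%:R)) lerD//; have /andP[] := ln_succ_diff n.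
Qed.

Lemma harm_le_ln n : harm n.+1 <= 1 + ln n.+1%:R.
Proof.
elim: n => [|n IH]; first by rewrite /harm big_ord1 ln1 invr1 addr0.
rewrite /harm big_ord_recr /=.
rewrite -[ln _](subrKC (ln n.+1%:R)) addrA lerD//.
by have /andP[] := ln_succ_diff n.
Qed.

(** * The weighted sum test and its risk *)

Section Detection.
Variables (m : nat) (mu : R).
Hypothesis mu0 : 0 < mu.

(** The scale [mu / 2] is the optimal Chernoff tilt, so the weights serve directly as exponents. The
    threshold in [scan_test] is half the mean of the statistic under any path. *)
Definition weight (v : vert m) : R := mu / 2 * (vrow v).+1%:R^-1.
Definition weights : seq R := [seq weight v | v <- enum (vert m)].
Definition scan_test (x : (nV m).-tuple R) : bool :=
  mu ^+ 2 / 4 * harm m < dot weights (tval x).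

Lemma measurable_scan_test : measurable_fun setT scan_test.
Proof. exact: measurable_dot_test. Qed.

Lemma size_means_H1 (p : seq int) : size (means_H1 m mu p) = nV m.
Proof. by rewrite size_map -cardE. Qed.

Lemma means_H0E : means_H0 m = nseq (nV m) 0 :> seq R.
Proof. by rewrite /means_H0 /nV cardE; elim: (enum _) => //= v s ->. Qed.

Lemma dot_weights_path p : is_path m p ->
  dot weights (means_H1 m mu p) = mu ^+ 2 / 2 * harm m.
Proof.
move=> pp; rewrite dot_map big_enum /= /harm -(sum_on_path (fun t => t.+1%:R^-1) pp) mulr_sumr.
rewrite [RHS]big_mkcond; apply: eq_bigr => v _; rewrite /weight.
by case: ifP => _; rewrite ?mulr0//; field.
Qed.

Lemma dot_weights_le : dot weights weights <= mu ^+ 2 / 4 * harm m.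
Proof.
rewrite dot_map big_enum /=.
apply: (@le_trans _ _ (\sum_(t < m) t.+1%:R * (mu / 2 * t.+1%:R^-1) ^+ 2)).
  rewrite -[leLHS]/(\sum_(v : vert m) (mu / 2 * (vrow v).+1%:R^-1) ^+ 2).
  apply: (@sum_row_le m (fun t => (mu / 2 * t.+1%:R^-1) ^+ 2)) => t.
  exact: sqr_ge0.
rewrite mulr_sumr; apply: ler_sum => t _.
rewrite le_eqVlt; apply/orP; left; apply/eqP; field.
by rewrite gt_eqF// ltr0n.
Qed.

Lemma risk_scan_test_le :
  (risk mu scan_test <= (2 * expR (- (mu ^+ 2 / 8 * harm m)))%:E)%E.
Proof.
have mT := measurable_scan_test.
have sw : size weights = nV m by rewrite size_map -cardE.
set c := mu ^+ 2 / 4 * harm m.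
have rej : (prob_reject (means_H0 m) scan_test <=
    (expR (- (mu ^+ 2 / 8 * harm m)))%:E)%E.
  rewrite /prob_reject means_H0E.
  rewrite (@eq_gauss_int _ _ _ (fun s => ((c < dot weights s)%R%:R)%:E)); last first.
    by move=> s; rewrite size_nseq => ss; rewrite /scan_test val_to_tuple.
  apply: le_trans (@gauss_int_chernoff _ _ weights (- c) _ _ _ _) _.
  - by rewrite size_nseq.
  - rewrite size_nseq; apply/measurable_EFinP.
    by apply: (measurableT_comp (f := fun b : bool => b%:R : R)) => //;
       exact: measurable_dot_test.
  - by move=> s cs; rewrite subr_ge0 ltW.
  (* Half the variance is at most [mu ^+ 2 / 8 * harm m], and the threshold subtracts twice that
     amount. *)
  rewrite dot0r lee_fin ler_expR add0r.
  by have := dot_weights_le; rewrite /c; lra.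
have acc p : is_path m p ->
    (prob_reject (means_H1 m mu p) (fun x => ~~ scan_test x) <=
    (expR (- (mu ^+ 2 / 8 * harm m)))%:E)%E.
  move=> pp; rewrite /prob_reject.
  rewrite (@eq_gauss_int _ _ _ (fun s => ((~~ (c < dot weights s)%R)%:R)%:E)); last first.
    by move=> s; rewrite size_means_H1 => ss; rewrite /scan_test val_to_tuple.
  (* Acceptance is a lower tail event, hence the opposite tilt. *)
  apply: le_trans (@gauss_int_chernoff _ _ (map -%R weights) c _ _ _ _) _.
  - by rewrite size_map sw size_means_H1.
  - rewrite size_means_H1; apply/measurable_EFinP.
    apply: (measurableT_comp (f := fun b : bool => b%:R : R)) => //.
    by apply: measurable_negb_test; exact: measurable_dot_test.
  - by move=> s; rewrite -leNgt dotNl addrC subr_ge0.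
  rewrite !dotNl dot_weights_path// [dot weights _]dotC dotNl opprK lee_fin ler_expR.
  by have := dot_weights_le; rewrite /c; lra.
rewrite mulrDl mul1r EFinD; apply: leeD => //.
by apply: ge_ereal_sup => _ [p pp <-]; exact: acc.
Qed.

End Detection.

Lemma risk_ge0 m (mu : R) (T : (nV m).-tuple R -> bool) : (0 <= risk mu T)%E.
Proof.
apply: adde_ge0; first by apply: gauss_int_ge0 => s; rewrite lee_fin.
(* A zigzag path shows that the supremum ranges over a nonempty set. *)
have pp : is_path m (mkseq (fun i => (odd i)%:Z) m).
  split; first by rewrite size_mkseq.
  split=> [|i im]; first by have [->//|m0] := posnP m; rewrite nth_mkseq.
  by rewrite !nth_mkseq// ?(ltnW im)//=; case: (odd i).
apply: le_trans (ereal_sup_ubound _); last by exists (mkseq (fun i => (odd i)%:Z) m).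
by apply: gauss_int_ge0 => s; rewrite lee_fin.
Qed.

Lemma detection_possible (mu : nat -> R) : (forall m, 0 < mu m) ->
  (fun m => mu m * Num.sqrt (ln (m%:R : R))) @ \oo --> +oo ->
  (fun m => risk (mu m) (@scan_test m (mu m))) @ \oo --> 0%E.
Proof.
move=> mu0 /cvgryPge muoo.
pose B m : R := 2 * expR (- (mu m ^+ 2 / 8 * harm m)).
apply: (@squeeze_cvge _ _ _ _ (cst 0%E) _ (EFin \o B)); last 2 first.
- exact: cvg_cst.
- apply: cvg_EFin; first by apply: nearW.
  apply/cvgr0Pnorm_le => e e0; near=> m.
  have m0 : (0 < m)%N by near: m; exact: nbhs_infty_gt.
  (* Squaring gives [y >= (16 / e) / 8 = 2 / e], and then [2 exp (- y) <= 2 / y <= e]. *)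
  have A : (16 / e + 1) <= mu m * Num.sqrt (ln (m%:R : R)) by near: m; exact: muoo.
  rewrite ger0_norm /= ?mulr_ge0// ?expR_ge0//.
  rewrite /B; set y := mu m ^+ 2 / 8 * harm m.
  have e16 : 0 < 16 / e by rewrite divr_gt0.
  have yA : 2 / e <= y.
    have lnm : 0 <= ln (m%:R : R) by rewrite ln_ge0// ler1n.
    have hm : ln (m%:R : R) <= harm m by case: (m) m0 => // n _; exact: ln_le_harm.
    have : (16 / e + 1) ^+ 2 <= mu m ^+ 2 * ln (m%:R : R).
      rewrite -[in leRHS](sqr_sqrtr lnm) -exprMn lerXn2r// ?nnegrE.
      - by rewrite addr_ge0// ltW.
      - by rewrite mulr_ge0// ltW.
    have : mu m ^+ 2 * ln (m%:R : R) <= mu m ^+ 2 * harm m.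
      by rewrite ler_wpM2l ?sqr_ge0.
    have -> : 2 / e = (16 / e) / 8 by field; rewrite gt_eqF.
    rewrite /y; move: e16; set a := 16 / e; nra.
  have y0 : 0 < y by apply: lt_le_trans yA; rewrite divr_gt0.
  rewrite expRN; apply: (@le_trans _ _ (2 * y^-1)).
    rewrite ler_wpM2l// lef_pV2 ?posrE ?expR_gt0//.
    by apply: le_trans (expR_ge1Dx _); rewrite lerDr.
  by rewrite ler_pdivrMr// mulrC -ler_pdivrMr.
- near=> m; rewrite risk_ge0 /=; exact: risk_scan_test_le.
Unshelve. all: by end_near. Qed.

End Lattice.

(** * Impossibility of detection *)

Section Undetectable.
Variable R : realType.

Definition path_of S m (w : clocks S m) : seq int :=
  mkseq (fun t => (2 * height w t)%:Z - t%:Z) m.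

Lemma path_of_is_path S m (w : clocks S m) : is_path m (path_of w).
Proof.
split; first by rewrite size_mkseq.
split=> [|i im].
  have [m0|m0] := posnP m; first by rewrite nth_default// size_mkseq m0.
  by rewrite nth_mkseq// /height big_ord0.
rewrite !nth_mkseq ?(ltnW im)// /height big_ord_recr /=.
by case: (up w i); lia.
Qed.

(** The inner product is [mu ^+ 2] times the number of common vertices, counted row by row. *)
Lemma dot_means_H1 m (mu : R) p q : is_path m p ->
  dot (means_H1 m mu p) (means_H1 m mu q) =
  \sum_(t < m) mu ^+ 2 * (nth 0 p t == nth 0 q t)%:R.
Proof.
move=> pp; rewrite dot_map big_enum /=.
rewrite -(sum_on_path (fun t => mu ^+ 2 * (nth 0 p t == nth 0 q t)%:R) pp).
rewrite [RHS]big_mkcond; apply: eq_bigr => v _.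
case: ifPn => [/eqP pv|_]; last by rewrite mul0r.
rewrite /on_path pv [in RHS]eq_sym; case: eqP => _; last by rewrite !mulr0.
by rewrite mulr1 expr2.
Qed.

(** A hit indicator [h] is 0 or 1, so [exp (mu^2 h) = 1 + (exp (mu^2) - 1) h]; this is the product
    form bounded by [sum_prod_hit]. *)
Lemma expR_dot_path_of S m (w w' : clocks S m) (mu : R) :
  expR (dot (means_H1 m mu (path_of w)) (means_H1 m mu (path_of w'))) =
  \prod_(t < m) (1 + (expR (mu ^+ 2) - 1) * (hit (height w) w' t)%:R).
Proof.
rewrite dot_means_H1; last exact: path_of_is_path.
rewrite expR_sum; apply: eq_bigr => t _.
rewrite !nth_mkseq// /hit.
rewrite (_ : (_ - _ == _) = (height w' t == height w t)); last first.
  by apply/eqP/eqP; lia.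
by case: eqP => _; rewrite ?mulr1 ?mulr0 ?expR0 ?addr0// subrKC.
Qed.

(** From [exp (- x) >= 1 - x] one gets [exp x <= 1 / (1 - x)], which is at most [1 + 2 x] on this
    range. *)
Lemma expR_sub1_le (x : R) : 0 <= x -> x <= 1 / 2 -> expR x - 1 <= 2 * x.
Proof.
move=> x0 x1; have x10 : 0 < 1 - x by lra.
have : expR x <= (1 - x)^-1.
  by rewrite -[expR x]invrK -expRN lef_pV2 ?posrE ?expR_gt0// expR_ge1Dx.
move=> /le_trans h'; rewrite lerBlDr; apply: h'.
rewrite -[leLHS]mul1r ler_pdivrMr// -subr_ge0.
rewrite (_ : _ - 1 = x * (1 - 2 * x)); last by ring.
by rewrite mulr_ge0//; lra.
Qed.

Lemma ln2_ge : 1 / 2 <= ln (2 : R).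
Proof.
have : ln (1 + - (1 / 2)) <= - (1 / 2) :> R by apply: le_ln1Dx; lra.
rewrite (_ : 1 + _ = 2^-1); last by field.
by rewrite lnV ?posrE//; lra.
Qed.

Lemma trunc_log_le_ln m : (0 < m)%N ->
  (trunc_log 2 m).+1%:R <= 1 + 2 * ln (m%:R : R).
Proof.
move=> m0; have /andP[h _] := trunc_log_bounds (isT : (1 < 2)%N) m0.
have h1 : ln 2 * (trunc_log 2 m)%:R <= ln (m%:R : R).
  rewrite mulr_natr -lnXn//.
  by rewrite ler_ln ?posrE ?exprn_gt0 ?ltr0n// -natrX ler_nat.
rewrite -natr1 [leLHS]addrC lerD2l; apply: (@le_trans _ _ (2 * (ln 2 * (trunc_log 2 m)%:R))).
  by rewrite mulrA ler_peMl//; have := ln2_ge; lra.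
by rewrite ler_wpM2l.
Qed.

Lemma average_le_sup m (mu : R) (T : (nV m).-tuple R -> bool) (I : finType)
    (p : I -> seq int) : (0 < #|I|)%N -> (forall i, is_path m (p i)) ->
  ((#|I|%:R^-1)%:E * (\sum_i prob_reject (means_H1 m mu (p i)) (fun x => ~~ T x))
    <= ereal_sup [set prob_reject (means_H1 m mu p) (fun x => ~~ T x)
             | p in [set p | is_path m p]])%E.
Proof.
move=> I0 pp; set M := ereal_sup _.
rewrite lee_pdivrMl ?ltr0n//.
apply: (@le_trans _ _ (\sum_(i : I) M)%E).
  apply: lee_sum => i _; apply: ereal_sup_ubound.
  by exists (p i) => //=; exact: pp.
by rewrite sumr_const mule_natl.
Qed.

Lemma risk_ge m (mu e : R) (T : (nV m).-tuple R -> bool) : (0 < m)%N ->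
  0 < mu -> 0 < e -> e <= 1 -> measurable_fun setT T ->
  1 <= ln (m%:R : R) -> mu * ln (m%:R : R) <= e / 10 ->
  ((1 - 2 * e)%:E <= risk mu T)%E.
Proof.
move=> m0 mu0 e0 e1 mT; set l := ln _ => l1 mul_le.
pose S := (trunc_log 2 m).+1.
have mS : (m <= 2 ^ S)%N by rewrite ltnW// trunc_log_ltn.
have N0 : (0 < #|clocks S m|)%N by rewrite card_ffun card_ord expn_gt0 expn_gt0.
pose a := expR (mu ^+ 2) - 1.
pose Theta : R := 4 * S%:R * \sum_(1 <= k < m) k%:R^-1.
have a0 : 0 <= a by rewrite subr_ge0 -expR0 ler_expR sqr_ge0.
have mue : mu <= e / 10 by apply: le_trans mul_le; rewrite ler_peMr// ltW.
have a1 : a <= 2 * mu ^+ 2 by apply: expR_sub1_le; [exact: sqr_ge0|nra].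
have S3 : S%:R <= 3 * l.
  by apply: le_trans (trunc_log_le_ln m0) _; rewrite -/l; lra.
have H0 : 0 <= \sum_(1 <= k < m) (k%:R^-1 : R) by rewrite sumr_ge0.
have H2 : \sum_(1 <= k < m) (k%:R^-1 : R) <= 2 * l.
  apply: (@le_trans _ _ (harm R m)).
    by rewrite big_add1 big_mkord /harm; case: (m) m0 => // n _; rewrite big_ord_recr lerDl.
  have : harm R m <= 1 + l by rewrite /l; case: (m) m0 => // n _; exact: harm_le_ln.
  by move: l1; lra.
have Th0 : 0 <= Theta by rewrite mulr_ge0.
have Th : Theta <= 24 * l ^+ 2.
  rewrite /Theta (_ : 24 * l ^+ 2 = 4 * (3 * l) * (2 * l)); last by ring.
  by rewrite ler_pM// ?mulr_ge0// ler_wpM2l.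
(* Here [a * Theta <= 48 (mu l)^2 <= 48 e^2 / 100], so that [C = 1 + e^2] meets the condition of
   [sum_prod_hit]. *)
have aTh : a * Theta <= e ^+ 2 / 2.
  apply: (@le_trans _ _ (2 * mu ^+ 2 * (24 * l ^+ 2))); first exact: ler_pM.
  have : 0 <= mu * l by rewrite mulr_ge0 ?ltW//; lra.
  rewrite (_ : _ * (24 * _) = 48 * (mu * l) ^+ 2); last by ring.
  by move: mul_le; set u := mu * l; nra.
have aC : 1 + a * Theta * (1 + e ^+ 2) <= 1 + e ^+ 2.
  have : e ^+ 2 <= 1 by rewrite expr_le1// ltW.
  have : 0 <= a * Theta by rewrite mulr_ge0.
  by move: aTh; set u := a * Theta; nra.
have e2 : 0 <= e ^+ 2 by exact: sqr_ge0.
have C0 : 0 <= 1 + e ^+ 2 by rewrite addr_ge0.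
(* The constant [K = 1 + 4 e^2] is chosen so that [(K - 1) / (4 e) = e] in [average_risk_ge]; it
   dominates [(1 + a) * (1 + e^2)]. *)
have second_moment : \sum_(w : clocks S m) \sum_(w' : clocks S m)
    expR (dot (means_H1 m mu (path_of w)) (means_H1 m mu (path_of w')))
    <= (1 + 4 * e ^+ 2) * #|clocks S m|%:R ^+ 2.
  apply: (@le_trans _ _ (\sum_(w : clocks S m) (1 + 4 * e ^+ 2) * #|clocks S m|%:R)).
    apply: ler_sum => w _; under eq_bigr do rewrite expR_dot_path_of -/a.
    apply: le_trans (sum_prod_hit (ltn0Sn _) mS (height w) m0 a0 C0 aC) _.
    rewrite ler_wpM2r//.
    have : e ^+ 2 <= 1 by rewrite expr_le1// ltW.
    by move: a0 a1 mue mu0; nra.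
  by rewrite sumr_const -[leLHS]mulr_natr -mulrA expr2.
have sms (w : clocks S m) : size (means_H1 m mu (path_of w)) = nV m.
  exact: size_means_H1.
have := average_risk_ge N0 sms e0 mT second_moment.
rewrite (_ : 1 - e - _ = 1 - 2 * e); last by field; rewrite gt_eqF.
move=> /le_trans; apply; rewrite /risk means_H0E leeD2l//.
by apply: average_le_sup => // w; exact: path_of_is_path.
Qed.

Lemma limn_einf_ge (u : (\bar R)^nat) (c : R) :
  (\forall m \near \oo, c%:E <= u m)%E -> (c%:E <= limn_einf u)%E.
Proof.
move=> [N _ Nc]; rewrite limn_einf_lim (cvg_lim _ (@cvg_einfs_sup _ u))//.
apply: le_trans (ereal_sup_ubound _); last by exists N.
by apply: le_ereal_inf_tmp => _ [k /= Nk <-]; exact: Nc.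
Qed.

Lemma near_ln_ge (A : R) : \forall m \near \oo, A <= ln (m%:R : R).
Proof.
near=> m.
have h : expR A <= m%:R by near: m; exact: nbhs_infty_ger.
by rewrite -[A]expRK ler_ln ?posrE ?expR_gt0// (lt_le_trans _ h)// expR_gt0.
Unshelve. all: by end_near. Qed.

Lemma detection_impossible (mu : nat -> R) : (forall m, 0 < mu m) ->
  (fun m : nat => mu m * ln (m%:R : R) * Num.sqrt (ln (ln (m%:R : R)))) @ \oo --> 0 ->
  forall T : forall m : nat, (nV m).-tuple R -> bool,
    (forall m, measurable_fun setT (T m)) ->
    (1 <= limn_einf (fun m => risk (mu m) (T m)))%E.
Proof.
move=> mu0 /cvgr0Pnorm_le mu_to0 T mT; apply/lee_addgt0Pr => d d0.
pose e := Num.min 1 (d / 2).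
have e0 : 0 < e by rewrite lt_min ltr01 divr_gt0.
rewrite -leeBlDr// -EFinB.
apply: (@le_trans _ _ (1 - 2 * e)%:E).
  have : e <= d / 2 by rewrite ge_min lexx orbT.
  by rewrite lee_fin; lra.
apply: limn_einf_ge; near=> m.
have m0 : (0 < m)%N by near: m; exact: nbhs_infty_gt.
have l1 : 1 <= ln (m%:R : R) by near: m; exact: near_ln_ge.
(* This makes [sqrt (ln (ln m))] at least 1, so the whole product bounds [mu m * ln m]. *)
have ll : expR 1 <= ln (m%:R : R) by near: m; exact: near_ln_ge.
apply: risk_ge => //; first by rewrite ge_min lexx.
have mul0 : 0 <= mu m * ln (m%:R : R) by rewrite mulr_ge0 ?ltW// (lt_le_trans ltr01).
have : `|mu m * ln (m%:R : R) * Num.sqrt (ln (ln (m%:R : R)))| <= e / 10.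
  by near: m; apply: mu_to0; rewrite divr_gt0.
rewrite (ger0_norm (mulr_ge0 mul0 (sqrtr_ge0 _))); apply: le_trans.
rewrite ler_peMr// -[leLHS]sqrtr1 ler_wsqrtr// -[leLHS]expRK.
by rewrite ler_ln ?posrE ?expR_gt0// (lt_le_trans ltr01).
Unshelve. all: by end_near. Qed.

End Undetectable.

Theorem theorem1p1 (R : realType) (mu : nat -> R) (mu_gt0 : forall m, 0 < mu m) :
  ( ((fun m : nat => mu m * Num.sqrt (ln (m%:R : R))) @ \oo --> +oo) ->
    exists T : forall m : nat, (nV m).-tuple R -> bool,
      (forall m, measurable_fun setT (T m)) /\
      ((fun m => risk (mu m) (T m)) @ \oo --> 0%E) )
  /\
  ( ((fun m : nat => mu m * ln (m%:R : R) * Num.sqrt (ln (ln (m%:R : R)))) @ \oo --> 0) ->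
    forall T : forall m : nat, (nV m).-tuple R -> bool,
      (forall m, measurable_fun setT (T m)) ->
      (1 <= limn_einf (fun m => risk (mu m) (T m)))%E ).
Proof.
split; last exact: detection_impossible.
move=> muoo; exists (fun m => @scan_test R m (mu m)); split.
  by move=> m; exact: measurable_scan_test.
exact: detection_possible.
Qed.
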